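(* Assume that, for each $v\in\{0,1\}$, the intersection of $\{x:U(x,v)=0\}$ with the invariant set of $F_v$ contains only the origin. Let $\{V^i(\cdot,\cdot)\}_{i\ge0}$ be generated by stabilizing action dependent value iteration, let $V^*(\cdot,\cdot)$ be the optimal action dependent value function, and let $v^i(x)=\operatorname*{arg\,min}_{w\in\{0,1\}}V^i(x,w)$ and $v^*(x)=\operatorname*{arg\,min}_{w\in\{0,1\}}V^*(x,w)$. For $r\in\mathbb{R}^+$ let $$\mathcal{B}^i_r:=\{x\in\mathbb{R}^n:V^i\big(x,v^i(x)\big)\le r\},\qquad \mathcal{B}^*_r:=\{x\in\mathbb{R}^n:V^*\big(x,v^*(x)\big)\le r\}.$$ Let the system be operated using the triggering policy $v^k(\cdot)$ at time $k$, i.e. $x_{k+1}=F_{v^k(x_k)}(x_k)$ for $k=0,1,2,\dots$. If $\mathcal{B}^*_r\subset\Omega$ for an $r>0$, then $\mathcal{B}^0_r$ is an estimation of the region of attraction of this closed loop system.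
   Context: Setting. A plant $x_{k+1}=f(x_k,u_k)$ has $f:\mathbb{R}^n\times\mathbb{R}^m\to\mathbb{R}^n$ continuous, $f(0,0)=0$, and a continuous control policy $h:\mathbb{R}^n\to\mathbb{R}^m$ is given, admissible in the sense that $h(0)=0$, $h$ asymptotically stabilizes $x_{k+1}=f(x_k,h(x_k))$ within the compact set $\Omega$, and $V_h(x_0):=\sum_{k=0}^\infty U(x_k^h,0)$ is continuous in $\Omega$, where $x_0^h=x_0$, $x_k^h=f(x_{k-1}^h,h(x_{k-1}^h))$. The switched system is $x_{k+1}=F_{v_k}(x_k)$, $v_k\in\{0,1\}$, with $F_0(x)=f(x,0)$ (network not used) and $F_1(x)=f(x,h(x))$ (network used). The infinite-horizon cost is $J=\sum_{k=0}^\infty U(x_k,v_k)$, where $U:\mathbb{R}^n\times\{0,1\}\to\mathbb{R}^+$ ($\mathbb{R}^+$ denotes the non-negative reals) is positive semi-definite and continuous in its first argument. Meaning of the invariant-set assumption: there is no set of states other than $\{0\}$ in which a trajectory can stay forever with zero running cost, i.e. without converging to the origin. A triggering policy is a map $w(\cdot)$ from states to $\{0,1\}$. Its action dependent value function is $V_w(x_0,v):=U(x_0,v)+\sum_{k=1}^\infty U(x_k^w,w(x_k^w))$, where $x_1^w:=F_v(x_0)$ and $x_k^w:=F_{w(x_{k-1}^w)}(x_{k-1}^w)$ for $k\ge2$. It is admissible if $V_w(\cdot,v)$ is continuous (hence bounded) in the compact set $\Omega$ for every $v\in\{0,1\}$. Stabilizing action dependent value iteration is the recursion $$V^{i+1}(x,v)=U(x,v)+\min_{w'\in\{0,1\}}V^i\big(F_v(x),w'\big),\quad\forall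 x,\ \forall v\in\{0,1\},$$ initiated with $V^0=V_w$, the action dependent value function of an admissible triggering policy $w(\cdot)$. The optimal action dependent value function $V^*(x,v)$ is the infinite-horizon cost incurred if action $v$ is taken at the current time from state $x$ and optimal actions are taken at all future times; it satisfies $V^*(x,v)=U(x,v)+\min_{w'\in\{0,1\}}V^*(F_v(x),w')$. An estimation of the region of attraction is a set of initial states from which every trajectory of the closed-loop system converges to the origin (a subset of the region of attraction).
   Formalization: The invariant-set assumption is imposed on the switched system (no set other than {0} is invariant under zero-cost transitions with v allowed to change at each step), not separately on each F_v; read for each v separately, the claim is false, since switching can cycle at zero cost. *)

(* Defs.v *)
From HB Require Import structures.
From mathcomp Require Import all_boot all_order all_algebra.
From mathcomp Require Import all_classical all_reals all_analysis.
Import numFieldNormedType.Exports.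
Set Implicit Arguments.
Unset Strict Implicit.
Unset Printing Implicit Defensive.
Import Order.TTheory GRing.Theory Num.Theory.
Local Open Scope classical_set_scope.
Local Open Scope ring_scope.

(* The action set {0, 1} is [bool]: [false] is 0 (network not used) and
   [true] is 1 (network used). *)
Definition mode {R : realType} {n m : nat}
    (f : 'rV[R]_n * 'rV[R]_m -> 'rV[R]_n) (h : 'rV[R]_n -> 'rV[R]_m)
    (v : bool) (x : 'rV[R]_n) : 'rV[R]_n :=
  f (x, if v then h x else 0).

Definition asymptotically_stable_within {R : realType} {n : nat}
    (G : 'rV[R]_n -> 'rV[R]_n) (Omega : set 'rV[R]_n) : Prop :=
  (forall N, nbhs (0 : 'rV[R]_n) N -> exists2 M, nbhs (0 : 'rV[R]_n) M &
     forall x k, Omega x -> M x -> N (iter k G x)) /\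
  (forall x, Omega x -> iter k G x @[k --> \oo] --> (0 : 'rV[R]_n)).

(* Values of infinite sums of costs live in [\bar R], so that "continuous in
   Omega" includes finiteness on Omega; they may be [+oo] elsewhere. *)
Definition finite_continuous_in {R : realType} {n : nat}
    (Omega : set 'rV[R]_n) (V : 'rV[R]_n -> \bar R) : Prop :=
  (forall x, Omega x -> V x \is a fin_num) /\ {within Omega, continuous V}.

Section ActionDependentCost.
Context {R : realType} {n : nat}.
Variables (F : bool -> 'rV[R]_n -> 'rV[R]_n) (U : 'rV[R]_n -> bool -> R).

Definition control_value (x : 'rV[R]_n) : \bar R :=
  (\sum_(0 <= k <oo) (U (iter k (F true) x) false)%:E)%E.

Definition triggered (w : 'rV[R]_n -> bool) (x : 'rV[R]_n) : 'rV[R]_n :=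
  F (w x) x.

(* The term of index k is the cost at time k + 1: the state at that time is
   reached from F v x by applying w at the k subsequent steps. *)
Definition policy_value (w : 'rV[R]_n -> bool) (x : 'rV[R]_n) (v : bool)
    : \bar R :=
  ((U x v)%:E +
   \sum_(0 <= k <oo) (let y := iter k (triggered w) (F v x) in
                      (U y (w y))%:E))%E.

Fixpoint value_iteration (V0 : 'rV[R]_n -> bool -> \bar R) (i : nat)
    : 'rV[R]_n -> bool -> \bar R :=
  if i is j.+1 then
    fun x v => ((U x v)%:E +
      Order.min (value_iteration V0 j (F v x) false)
                (value_iteration V0 j (F v x) true))%E
  else V0.

Fixpoint switched_state (a : nat -> bool) (x : 'rV[R]_n) (k : nat)
    : 'rV[R]_n :=
  if k is j.+1 then F (a j) (switched_state a x j) else x.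

Definition switched_cost (a : nat -> bool) (x : 'rV[R]_n) : \bar R :=
  (\sum_(0 <= k <oo) (U (switched_state a x k) (a k))%:E)%E.

Definition optimal_value (x : 'rV[R]_n) (v : bool) : \bar R :=
  ereal_inf [set switched_cost a x | a in [set a : nat -> bool | a 0%N = v]].

(* For a single map F and a set S of zeros of the running cost this is
   F @` S = S, the invariance of LaSalle's principle.  For the switched system
   each point of S has a successor in S, and a predecessor in S, along a
   transition of zero cost, the action being allowed to change at every step;
   equivalently, S is a union of complete trajectories (indexed by all
   integers) of zero running cost. *)
Definition zero_cost_invariant (S : set 'rV[R]_n) : Prop :=
  (forall x, S x -> exists v, U x v = 0 /\ S (F v x)) /\
  (forall y, S y -> exists x v, [/\ S x, U x v = 0 & F v x = y]).

End ActionDependentCost.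

(* A selection of the argmin, with arbitrary tie-breaking. *)
Definition is_argmin {R : realType} {n : nat}
    (V : 'rV[R]_n -> bool -> \bar R) (v : 'rV[R]_n -> bool) : Prop :=
  forall x w, (V x (v x) <= V x w)%E.

Definition sublevel {R : realType} {n : nat}
    (V : 'rV[R]_n -> bool -> \bar R) (v : 'rV[R]_n -> bool) (r : R)
    : set 'rV[R]_n :=
  [set x | (V x (v x) <= r%:E)%E].

(* The time-varying system x_{k+1} = G k (x_k), started at time 0. *)
Definition attraction_estimate {R : realType} {n : nat}
    (G : nat -> 'rV[R]_n -> 'rV[R]_n) (B : set 'rV[R]_n) : Prop :=
  forall x : nat -> 'rV[R]_n, B (x 0%N) ->
    (forall k, x k.+1 = G k (x k)) -> x k @[k --> \oo] --> (0 : 'rV[R]_n).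

(* Main.v *)
(* Value iteration started from a policy value is nonincreasing in i, and every
   iterate is the cost of some action sequence, hence bounds V* from above.
   Along the closed loop E_k = V^k(x_k, v^k(x_k)) therefore satisfies
   U(x_k, v^k(x_k)) + E_(k+1) <= E_k, so the trajectory stays in the sublevel
   set of V*, inside the compact set Omega, and its running costs tend to 0.
   Its omega-limit set is then zero-cost invariant, hence reduced to the origin,
   and compactness turns this into convergence. *)
Require Import Defs.
From HB Require Import structures.
From mathcomp Require Import all_boot all_order all_algebra.
From mathcomp Require Import all_classical all_reals all_analysis.
Import numFieldNormedType.Exports.
Set Implicit Arguments.
Unset Strict Implicit.
Unset Printing Implicit Defensive.
Import Order.TTheory GRing.Theory Num.Theory.
Local Open Scope classical_set_scope.
Local Open Scope ring_scope.

(** * Ultrafilters and limits of sequences *)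

Lemma ultra_fmap (T T' : Type) (g : T -> T') (G : set_system T) :
  UltraFilter G -> UltraFilter (g @ G).
Proof.
move=> GU; split=> [|H HH GH]; first exact: fmap_proper_filter.
apply/seteqP; split=> [A HA|]; last exact: GH.
have [//|GnA] := in_ultra_setVsetC (g @^-1` A) GU.
have HnA : H (~` A) by apply: GH.
have [t [At nAt]] := filter_ex (filterI HA HnA).
by case: nAt.
Qed.

(** Plays the role of extracting a subsequence of times at which the action is constant, so that the
    continuity of a single mode can be used. *)
Lemma ultra_const (T : Type) (G : set_system T) (a : T -> bool) :
  UltraFilter G -> exists v, \forall t \near G, a t = v.
Proof.
move=> GU; have [Ga|Gna] := in_ultra_setVsetC (a @^-1` [set true]) GU.
  by exists true.
by exists false; apply: filterS Gna => t /= /negP /negbTE.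
Qed.

Lemma compact_ultra_cvg (I : Type) (T : topologicalType) (K : set T)
    (x : I -> T) (G : set_system I) :
  compact K -> (forall i, K (x i)) -> UltraFilter G -> exists p : T, x @ G --> p.
Proof.
move=> Kc xK GU; have xGK : (x @ G) K.
  exact: (filterS (fun i _ => xK i) filterT).
move: Kc; rewrite compact_ultra => /(_ _ (ultra_fmap x GU) xGK) [p [_ xp]].
by exists p.
Qed.

(** If [x] left a neighbourhood [A] of [p] infinitely often, the times spent outside [A] would
    generate a proper filter finer than [\oo]; an ultrafilter above it would contain both the times
    in [A] and those outside. *)
Lemma cvg_ultra_subseq (T : topologicalType) (x : nat -> T) (p : T) :
  (forall G : set_system nat, UltraFilter G -> \oo `<=` G -> x @ G --> p) ->
  x @ \oo --> p.
Proof.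
move=> H A pA; apply: contrapT => nA.
have PF : ProperFilter (within (~` (x @^-1` A)) \oo).
  apply: Build_ProperFilter_ex => B wB.
  have [//|nB] := pselect (exists k, B k).
  case: nA; change (\forall k \near \oo, A (x k)).
  apply: filterS (wB : \forall k \near \oo, ~ A (x k) -> B k) => k kB.
  by have [//|nAk] := pselect (A (x k)); case: nB; exists k; exact: kB.
have [G [GU wG]] := ultraFilterLemma PF.
have ooG : \oo `<=` G by move=> B ooB; apply: wG; exact: (cvg_within _ ooB).
have GA : G (x @^-1` A) by exact: (H G GU ooG).
have GnA : G (~` (x @^-1` A)).
  by apply: wG; exact: (nearW _ (fun k nAk => nAk)).
by have [k []] := filter_ex (filterI GA GnA).
Qed.

(** * Limit points of trajectories with vanishing running cost *)

Lemma continuous_graph (T T' : topologicalType) (g : T -> T') :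
  continuous g -> continuous (fun x => (x, g x)).
Proof. by move=> gc x; apply: cvg_pair; [exact: cvg_id|exact: gc]. Qed.

Lemma mode_continuous (R : realType) (n m : nat)
    (f : 'rV[R]_n * 'rV[R]_m -> 'rV[R]_n) (h : 'rV[R]_n -> 'rV[R]_m) (v : bool) :
  continuous f -> continuous h -> continuous (mode f h v).
Proof.
move=> fc hc x; apply: (@continuous_comp _ _ _
  (fun x => (x, if v then h x else 0)) f); last exact: fc.
by apply: continuous_graph; case: v => //; exact: cst_continuous.
Qed.

Lemma rV_hausdorff (R : realType) (n : nat) : hausdorff_space 'rV[R]_n.
Proof. exact: norm_hausdorff. Qed.

(* The states visited along ultrafilters of times form the omega-limit set;
   shifting the ultrafilter by one step forwards or backwards moves inside it. *)
Lemma cvg0_of_vanishing_cost (R : realType) (n : nat)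
    (F : bool -> 'rV[R]_n -> 'rV[R]_n) (U : 'rV[R]_n -> bool -> R)
    (Omega : set 'rV[R]_n) (a : nat -> bool) (x : nat -> 'rV[R]_n) :
  (forall v, continuous (F v)) -> (forall v, continuous (U ^~ v)) ->
  compact Omega ->
  (forall S, zero_cost_invariant F U S -> S `<=` [set 0]) ->
  (forall k, Omega (x k)) -> (forall k, x k.+1 = F (a k) (x k)) ->
  U (x k) (a k) @[k --> \oo] --> (0 : R) ->
  x k @[k --> \oo] --> (0 : 'rV[R]_n).
Proof.
move=> Fc Uc Oc inv xO xS U0.
pose S : set 'rV[R]_n := [set y | exists G : set_system nat,
  [/\ UltraFilter G, \oo `<=` G & x @ G --> y]].
have limit G : UltraFilter G -> exists y : 'rV[R]_n, x @ G --> y.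
  exact: (compact_ultra_cvg Oc xO).
(* Along [G] the action freezes to some [v]. The running cost then tends both to [U y v] and to 0,
   and the next states tend to [F v y]. *)
have step G y : UltraFilter G -> \oo `<=` G -> x @ G --> y ->
    exists v, U y v = 0 /\ x k.+1 @[k --> G] --> F v y.
  move=> GU ooG xy; have [v av] := ultra_const a GU; exists v; split.
    have Uy : U (x k) (a k) @[k --> G] --> U y v.
      apply: (cvg_trans _ (cvg_fmap (@Uc v y) xy)); apply: near_eq_cvg.
      by near=> k; rewrite (near av k).
    have U0G : U (x k) (a k) @[k --> G] --> (0 : R).
      by apply: cvg_trans U0 => A /ooG.
    exact: (cvg_unique (@norm_hausdorff _ _) Uy U0G).
  apply: (cvg_trans _ (cvg_fmap (@Fc v y) xy)); apply: near_eq_cvg.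
  by near=> k; rewrite xS (near av k).
have S0 : S `<=` [set 0].
  apply: inv; split=> [y|y] [G [GU ooG xy]].
    have [v [Uyv xSy]] := step _ _ GU ooG xy.
    (* The successor [F v y] is the limit of [x] along the ultrafilter shifted one step forwards. *)
    exists v; split=> //; exists (succn @ G); split=> //.
      exact: ultra_fmap.
    move=> A [N _ NA]; apply: ooG; exists N => // k Nk /=.
    by apply: NA => /=; exact: leqW.
  (* For a predecessor, shift one step backwards: compactness provides a limit [p] there, and [step]
     sends it to [y]. *)
  have predU : UltraFilter (predn @ G) by exact: ultra_fmap.
  have predoo : \oo `<=` predn @ G.
    move=> A [N _ NA]; apply: ooG; exists N.+1 => // k Nk /=; apply: NA => /=.
    by case: k Nk.
  have [p xp] := limit _ predU.
  have [v [Upv xSp]] := step _ _ predU predoo xp.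
  exists p, v; split=> //; first by exists (predn @ G).
  (* Since [predn 0] is 0, undoing the shift fails at time 0, which [G] ignores because it refines
     [\oo]. *)
  have xSp' : x @ G --> F v p.
    apply: (cvg_trans _ xSp); apply: near_eq_cvg; apply: ooG.
    by exists 1%N => // k /= k0; rewrite prednK.
  exact: (cvg_unique (@rV_hausdorff _ _) xSp' xy).
apply: cvg_ultra_subseq => G GU ooG; have [y xy] := limit _ GU.
suff <- : y = 0 by [].
by apply: S0; exists G.
Unshelve. all: by end_near.
Qed.

(** * Value iteration: monotonicity and comparison with the optimal value *)

Lemma value_iteration_argmin (R : realType) (n : nat)
    (F : bool -> 'rV[R]_n -> 'rV[R]_n) (U : 'rV[R]_n -> bool -> R)
    (V0 : 'rV[R]_n -> bool -> \bar R) (i : nat) (vi : 'rV[R]_n -> bool) :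
  is_argmin (value_iteration F U V0 i) vi -> forall x v,
  value_iteration F U V0 i.+1 x v =
  ((U x v)%:E + value_iteration F U V0 i (F v x) (vi (F v x)))%E.
Proof.
move=> vim x v /=; congr (_ + _)%E.
apply/le_anti/andP; split.
  by case: (vi _); rewrite ge_min lexx ?orbT.
by rewrite le_min !vim.
Qed.

Lemma policy_value_rec (R : realType) (n : nat)
    (F : bool -> 'rV[R]_n -> 'rV[R]_n) (U : 'rV[R]_n -> bool -> R)
    (w : 'rV[R]_n -> bool) :
  (forall x v, 0 <= U x v) -> forall x v,
  policy_value F U w x v =
  ((U x v)%:E + policy_value F U w (F v x) (w (F v x)))%E.
Proof.
move=> U0 x v; rewrite {1}/policy_value nneseries_recl //; last first.
  by move=> k _; rewrite lee_fin.
congr (_ + (_ + _))%E; rewrite -nneseries_addn; last by move=> k; rewrite lee_fin.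
by apply: eq_eseriesr => k _; rewrite addn1 iterSr.
Qed.

(** At the start, minimizing over the next action does at least as well as following [w]; afterwards
    the Bellman operator is monotone and preserves the inequality. *)
Lemma value_iteration_le (R : realType) (n : nat)
    (F : bool -> 'rV[R]_n -> 'rV[R]_n) (U : 'rV[R]_n -> bool -> R)
    (w : 'rV[R]_n -> bool) (i : nat) (x : 'rV[R]_n) (v : bool) :
  (forall x v, 0 <= U x v) ->
  (value_iteration F U (policy_value F U w) i.+1 x v <=
   value_iteration F U (policy_value F U w) i x v)%E.
Proof.
move=> U0; elim: i x v => [|i IH] x v.
  rewrite [leRHS]policy_value_rec //= leeD2l //.
  by case: (w _); rewrite ge_min lexx ?orbT.
rewrite [leRHS]/= [leLHS]/= leeD2l //.
by rewrite le_min !ge_min; apply/andP; split; apply/orP; [left|right]; exact: IH.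
Qed.

Lemma switched_cost_cons (R : realType) (n : nat)
    (F : bool -> 'rV[R]_n -> 'rV[R]_n) (U : 'rV[R]_n -> bool -> R)
    (a : nat -> bool) (x : 'rV[R]_n) :
  (forall x v, 0 <= U x v) ->
  switched_cost F U a x =
  ((U x (a 0%N))%:E + switched_cost F U (a \o succn) (F (a 0%N) x))%E.
Proof.
move=> U0; rewrite /switched_cost nneseries_recl //; last first.
  by move=> k _; rewrite lee_fin.
congr (_ + _)%E; rewrite -nneseries_addn; last by move=> k; rewrite lee_fin.
apply: eq_eseriesr => k _; rewrite addn1 /=; congr (U _ _)%:E.
by elim: k => //= k ->.
Qed.

Lemma policy_value_switched (R : realType) (n : nat)
    (F : bool -> 'rV[R]_n -> 'rV[R]_n) (U : 'rV[R]_n -> bool -> R)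
    (w : 'rV[R]_n -> bool) (x : 'rV[R]_n) (v : bool) :
  (forall x v, 0 <= U x v) ->
  exists2 a : nat -> bool, a 0%N = v &
    switched_cost F U a x = policy_value F U w x v.
Proof.
move=> U0.
exists (fun k => if k is j.+1 then w (iter j (triggered F w) (F v x)) else v) => //.
rewrite switched_cost_cons //=; congr (_ + _)%E.
apply: eq_eseriesr => k _ /=; congr (U _ _)%:E.
by elim: k => //= k ->.
Qed.

(** Each iteration prepends [v] to a sequence realizing the smaller of the two branches. Being an
    actual cost, the iterate dominates the infimum [optimal_value]. *)
Lemma value_iteration_switched (R : realType) (n : nat)
    (F : bool -> 'rV[R]_n -> 'rV[R]_n) (U : 'rV[R]_n -> bool -> R)
    (w : 'rV[R]_n -> bool) (i : nat) (x : 'rV[R]_n) (v : bool) :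
  (forall x v, 0 <= U x v) ->
  exists2 a : nat -> bool, a 0%N = v &
    switched_cost F U a x = value_iteration F U (policy_value F U w) i x v.
Proof.
move=> U0; elim: i x v => [|i IH] x v; first exact: policy_value_switched.
have [v' Vv'] : exists v', Order.min
    (value_iteration F U (policy_value F U w) i (F v x) false)
    (value_iteration F U (policy_value F U w) i (F v x) true) =
    value_iteration F U (policy_value F U w) i (F v x) v'.
  by rewrite minEle; case: ifP => _; [exists false|exists true].
have [a a0 aE] := IH (F v x) v'.
exists (fun k => if k is j.+1 then a j else v) => //.
by rewrite switched_cost_cons //= Vv' -aE.
Qed.

Lemma optimal_value_le (R : realType) (n : nat)
    (F : bool -> 'rV[R]_n -> 'rV[R]_n) (U : 'rV[R]_n -> bool -> R)
    (w : 'rV[R]_n -> bool) (i : nat) (x : 'rV[R]_n) (v : bool) :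
  (forall x v, 0 <= U x v) ->
  (optimal_value F U x v <= value_iteration F U (policy_value F U w) i x v)%E.
Proof.
move=> U0; have [a a0 <-] := value_iteration_switched F w i x v U0.
by apply: ereal_inf_lbound; exists a.
Qed.

Lemma optimal_value_ge0 (R : realType) (n : nat)
    (F : bool -> 'rV[R]_n -> 'rV[R]_n) (U : 'rV[R]_n -> bool -> R)
    (x : 'rV[R]_n) (v : bool) :
  (forall x v, 0 <= U x v) -> (0 <= optimal_value F U x v)%E.
Proof.
move=> U0; apply: le_ereal_inf_tmp => _ [a _ <-].
by apply: nneseries_ge0 => k _ _; rewrite lee_fin.
Qed.

(** By telescoping, the partial sums of [u] plus the remaining [E k] never exceed [r], so the series
    converges and its terms vanish. *)
Lemma cvg0_of_descent (R : realType) (u : nat -> R) (E : nat -> \bar R) (r : R) :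
  (forall k, 0 <= u k) -> (forall k, (0 <= E k)%E) -> (E 0%N <= r%:E)%E ->
  (forall k, ((u k)%:E + E k.+1 <= E k)%E) ->
  u @ \oo --> (0 : R).
Proof.
move=> u0 E0 Er Edec; apply: cvg_series_cvg_0.
have bound k : ((series u k)%:E + E k <= r%:E)%E.
  elim: k => [|k IH]; first by rewrite /series /= big_geq // add0e.
  rewrite seriesSr EFinD -addeA; apply: le_trans IH.
  by rewrite leeD2l.
apply: nondecreasing_is_cvgn; first exact: nondecreasing_series.
exists r => _ [k _ <-]; rewrite -lee_fin; apply: le_trans (bound k).
by rewrite leeDl.
Qed.

Theorem theorem7 (R : realType) (n m : nat)
    (f : 'rV[R]_n * 'rV[R]_m -> 'rV[R]_n) (h : 'rV[R]_n -> 'rV[R]_m)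
    (U : 'rV[R]_n -> bool -> R) (Omega : set 'rV[R]_n)
    (w : 'rV[R]_n -> bool)
    (vi : nat -> 'rV[R]_n -> bool) (vstar : 'rV[R]_n -> bool) (r : R)
    (F := mode f h)
    (V := value_iteration F U (policy_value F U w))
    (Vstar := optimal_value F U)
    (f_cont : continuous f) (f0 : f (0, 0) = 0)
    (Omega_compact : compact Omega)
    (h_cont : continuous h) (h0 : h 0 = 0)
    (h_stab : asymptotically_stable_within (F true) Omega)
    (Vh_cont : finite_continuous_in Omega (control_value F U))
    (U_ge0 : forall x v, 0 <= U x v) (U0 : U 0 false = 0)
    (U_cont : forall v, continuous (fun x => U x v))
    (w_admissible : forall v,
       finite_continuous_in Omega (fun x => policy_value F U w x v))
    (invariant_assumption : forall S : set 'rV[R]_n,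
       zero_cost_invariant F U S -> S `<=` [set 0])
    (vi_argmin : forall i, is_argmin (V i) (vi i))
    (vstar_argmin : is_argmin Vstar vstar)
    (r_gt0 : 0 < r)
    (Bstar_sub : sublevel Vstar vstar r `<=` Omega) :
  attraction_estimate (fun k x => F (vi k x) x) (sublevel (V 0%N) (vi 0%N) r).
Proof.
move=> x x0r xS.
have E_anti k : (V k.+1 (x k) (vi k (x k)) <= V k (x k) (vi k (x k)))%E.
  exact: value_iteration_le.
(* The recursion read backwards: the left side is [V k.+1] at the current state and action, so
   [E_anti] applies. *)
have Edec k : ((U (x k) (vi k (x k)))%:E + V k (x k.+1) (vi k (x k.+1)) <=
    V k (x k) (vi k (x k)))%E.
  by rewrite xS -value_iteration_argmin.
(* At the new state the iterate also changes: [vi k.+1] is minimal for [V k.+1], which lies below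
   [V k]. *)
have Edec' k : ((U (x k) (vi k (x k)))%:E + V k.+1 (x k.+1) (vi k.+1 (x k.+1)) <=
    V k (x k) (vi k (x k)))%E.
  apply: le_trans (Edec k); rewrite leeD2l //.
  by apply: le_trans (vi_argmin k.+1 _ (vi k (x k.+1))) _; exact: value_iteration_le.
have Er k : (V k (x k) (vi k (x k)) <= r%:E)%E.
  elim: k => // k; apply: le_trans; apply: le_trans (Edec' k).
  by rewrite leeDr // lee_fin.
apply: (@cvg0_of_vanishing_cost _ _ F U Omega (fun k => vi k (x k))) => //.
- by move=> v; exact: mode_continuous.
- move=> k; apply: Bstar_sub; apply: le_trans (Er k).
  by apply: le_trans (vstar_argmin _ (vi k (x k))) _; exact: optimal_value_le.
apply: (cvg0_of_descent (E := fun k => V k (x k) (vi k (x k))) (r := r)) => //.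
(* The iterates are nonnegative because they dominate the optimal value. *)
move=> k; apply: le_trans (optimal_value_le F w k _ _ U_ge0).
exact: optimal_value_ge0.
Qed.
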